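(* Consider the problem $\min_{x\in\mathbb{R}^d}F(x)$ with $F(x)=f(x)+\Psi(x)=\frac1n\sum_{i=1}^n f_i(x)+\Psi(x)$, and let $x^*$ be a minimizer of $F$. If each $f_i$ (not necessarily convex) is $L$-upper smooth and $l$-lower smooth for $l\ge L\ge0$, $f$ is $\sigma$-strongly convex, $\eta=\frac{\sigma}{25Ll}$, and $m\ge\frac{4}{\sigma\eta}=\Omega\big(\frac{Ll}{\sigma^2}\big)$, then $\mathtt{SVRG}(x^\phi,m,S,\eta)$ satisfies, for each epoch $s$, $$\mathbb{E}\big[F(\widetilde{x}^s)-F(x^* )\big]\le\frac34\big(F(\widetilde{x}^{s-1})-F(x^* )\big),$$ where the first $s-1$ epochs are assumed fixed and the only randomness comes from epoch $s$. Therefore, by setting $S=\log_{4/3}\big(\frac{F(x^\phi)-F(x^* )}{\varepsilon}\big)$, in a total gradient complexity of $$O\Big(\Big(n+\frac{Ll}{\sigma^2}\Big)\log\frac{F(x^\phi)-F(x^* )}{\varepsilon}\Big),$$ we obtain an output $\widetilde{x}^S$ satisfying $\mathbb{E}[F(\widetilde{x}^S)-F(x^* )]\le\varepsilon$.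
   Context: Setting: each $f_i:\mathbb{R}^d\to\mathbb{R}$ is differentiable; $\Psi$ is convex and lower semicontinuous (possibly non-differentiable). $\|\cdot\|$ is the Euclidean norm. A differentiable function $g$ is: $L$-upper smooth if $g(y)-g(x)-\langle\nabla g(x),y-x\rangle\le\frac L2\|y-x\|^2$ for all $x,y\in\mathbb{R}^d$; $l$-lower smooth if $g(y)-g(x)-\langle\nabla g(x),y-x\rangle\ge-\frac l2\|y-x\|^2$ for all $x,y$; $\sigma$-strongly convex if $g(y)-g(x)-\langle\nabla g(x),y-x\rangle\ge\frac\sigma2\|y-x\|^2$ for all $x,y$. The target accuracy is $\varepsilon$. Algorithm $\mathtt{SVRG}(x^\phi,m,S,\eta)$, with starting vector $x^\phi$, epoch length $m$, number of epochs $S$ and step length $\eta$: Set $\widetilde{x}^0=x^\phi$ and $x_0^1=x^\phi$. For epochs $s=1,\dots,S$: compute $\widetilde\mu_{s-1}=\nabla f(\widetilde{x}^{s-1})$; for $t=0,\dots,m-1$ pick $i$ uniformly at random in $\{1,\dots,n\}$, set $\xi=\nabla f_i(x_t^s)-\nabla f_i(\widetilde{x}^{s-1})+\widetilde\mu_{s-1}$ and $x_{t+1}^s=\arg\min_{y\in\mathbb{R}^d}\{\frac1{2\eta}\|x_t^s-y\|^2+\Psi(y)+\langle\xi,y\rangle\}$; after the inner loop set $\widetilde{x}^s=\frac1m\sum_{t=1}^m x_t^s$ and $x_0^{s+1}=\widetilde{x}^s$. Return $\widetilde{x}^S$. The gradient complexity is the total number of evaluations of component gradients $\nabla f_i(\cdot)$;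 a full gradient $\nabla f$ counts as $n$ evaluations. *)

(* Defs.v *)
From HB Require Import structures.
From mathcomp Require Import all_boot all_order all_algebra.
From mathcomp Require Import all_classical all_reals all_analysis.

Set Implicit Arguments.
Unset Strict Implicit.
Unset Printing Implicit Defensive.

Import Order.TTheory GRing.Theory Num.Theory.
Import numFieldNormedType.Exports.

Local Open Scope classical_set_scope.
Local Open Scope ring_scope.

Section Euclidean.
Variables (R : realType) (d : nat).
Implicit Types (x y : 'rV[R]_d) (g : 'rV[R]_d -> R).

Definition dot x y : R := \sum_i x ord0 i * y ord0 i.

(* The library norm `|x| on 'rV[R]_d is the sup norm, hence this one; both
   induce the same notion of differentiability. *)
Definition enorm x : R := Num.sqrt (dot x x).

Definition gradient g x : 'rV[R]_d :=
  \row_i 'D_(delta_mx ord0 i : 'rV[R]_d) g x.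

Definition bregman g x y : R := g y - g x - dot (gradient g x) (y - x).

Definition upper_smooth (L : R) g : Prop :=
  forall x y, bregman g x y <= L / 2 * enorm (y - x) ^+ 2.

Definition lower_smooth (l : R) g : Prop :=
  forall x y, - (l / 2) * enorm (y - x) ^+ 2 <= bregman g x y.

Definition strongly_convex (sigma : R) g : Prop :=
  forall x y, sigma / 2 * enorm (y - x) ^+ 2 <= bregman g x y.

End Euclidean.

(* Psi is allowed the value +oo (but neither -oo nor +oo identically), so that it
   can encode constraints; a real-valued h is covered as EFin \o h. *)
Definition proper_fun (R : realType) (d : nat) (h : 'rV[R]_d -> \bar R) : Prop :=
  (forall x, h x != -oo%E) /\ (exists x, h x \is a fin_num).

(* The library's 0 * +oo = 0 keeps this harmless at t = 0 and t = 1. *)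
Definition econvex (R : realType) (d : nat) (h : 'rV[R]_d -> \bar R) : Prop :=
  forall (x y : 'rV[R]_d) (t : R), 0 <= t <= 1 ->
    (h (t *: x + (1 - t) *: y)%R <= t%:E * h x + (1 - t)%:E * h y)%E.

Definition is_minimizer (R : realType) (d : nat) (G : 'rV[R]_d -> \bar R)
    (y : 'rV[R]_d) : Prop :=
  forall z, (G y <= G z)%E.

Definition argmin (R : realType) (d : nat) (G : 'rV[R]_d -> \bar R) : 'rV[R]_d :=
  get [set y | is_minimizer G y].

(* A value together with the number of component-gradient evaluations spent to
   compute it. *)
Definition counted (A : Type) : Type := (A * nat)%type.
Definition ret (A : Type) (a : A) : counted A := (a, 0%N).
Definition bind (A B : Type) (c : counted A) (k : A -> counted B) : counted B :=
  ((k c.1).1, (c.2 + (k c.1).2)%N).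
Definition value (A : Type) (c : counted A) : A := c.1.
Definition cost (A : Type) (c : counted A) : nat := c.2.
Notation "'let*' x ':=' c 'in' k" := (bind c (fun x => k))
  (at level 200, x name, c at level 200, k at level 200).

Section SVRG.
Variables (R : realType) (d n : nat).
Variables (f : 'I_n -> 'rV[R]_d -> R) (Psi : 'rV[R]_d -> \bar R).

Definition average (x : 'rV[R]_d) : R := n%:R^-1 * \sum_i f i x.

Definition objective (x : 'rV[R]_d) : \bar R := ((average x)%:E + Psi x)%E.

Definition component_gradient (i : 'I_n) (x : 'rV[R]_d) : counted 'rV[R]_d :=
  (gradient (f i) x, 1%N).

Definition full_gradient (x : 'rV[R]_d) : counted 'rV[R]_d :=
  (gradient average x, n).

Variables (m : nat) (eta : R).

Definition prox_step (x xi : 'rV[R]_d) : 'rV[R]_d :=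
  argmin (fun y =>
    (((2 * eta)^-1 * enorm (x - y) ^+ 2)%:E + Psi y + (dot xi y)%:E)%E).

Definition inner_step (snap mu x : 'rV[R]_d) (i : 'I_n) : counted 'rV[R]_d :=
  let* gx := component_gradient i x in
  let* gs := component_gradient i snap in
  ret (prox_step x (gx - gs + mu)).

(* The iterates x_1, x_2, ... (starting point excluded) for the drawn indices. *)
Fixpoint inner_loop (snap mu x : 'rV[R]_d) (w : seq 'I_n) :
    counted (seq 'rV[R]_d) :=
  if w is i :: w' then
    let* x' := inner_step snap mu x i in
    let* xs := inner_loop snap mu x' w' in
    ret (x' :: xs)
  else ret [::].

Definition epoch (snap : 'rV[R]_d) (w : m.-tuple 'I_n) : counted 'rV[R]_d :=
  let* mu := full_gradient snap in
  let* xs := inner_loop snap mu snap w in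
  ret (m%:R^-1 *: \sum_(x <- xs) x).

(* One m-tuple of drawn indices per epoch. *)
Fixpoint svrg (x : 'rV[R]_d) (ws : seq (m.-tuple 'I_n)) : counted 'rV[R]_d :=
  if ws is w :: ws' then
    let* x' := epoch x w in
    svrg x' ws'
  else ret x.

End SVRG.

(* Independent uniform draws from 'I_n are the same as one uniform draw from the
   (nested) tuples of indices, so all expectations are of this form. *)
Definition uniform_expectation (R : realType) (T : finType) (X : T -> \bar R) :
    \bar R :=
  ((#|T|%:R^-1 : R)%:E * \sum_(w : T) X w)%E.

Definition nat_ceil (R : realType) (x : R) : nat := absz (Num.max 0 (Num.ceil x)).

Definition log43 (R : realType) (x : R) : R := ln x / ln (4 / 3).

(* Main.v *)
Require Import Defs.
From HB Require Import structures.
From mathcomp Require Import all_boot all_order all_algebra.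
From mathcomp Require Import all_classical all_reals all_analysis.
From mathcomp Require Import finmap zify ring lra.
Set Implicit Arguments.
Unset Strict Implicit.
Unset Printing Implicit Defensive.
Import Order.TTheory GRing.Theory Num.Theory.
Import numFieldNormedType.Exports.
Local Open Scope ring_scope.

(* Write xs for the minimizer, g(x) = F(x) - F(xs), and B(y, x) for the Bregman
   divergence f(x) - f(y) - <grad f(y), x - y>. First-order optimality of xs for F
   gives B(xs, x) <= g(x), hence by strong convexity also
   sigma/2 |x - xs|^2 <= g(x).

   Variance: each f_i + l/2 |.|^2 is convex and (L + l)-smooth, so its gradient
   is cocoercive. Averaging over i, the cross terms add up to the symmetrised
   Bregman divergence of f itself, which is strongly convex, and this leaves
     mean_i |grad f_i(x) - grad f_i(xs)|^2 <= 2 L B(xs, x) + l (L - sigma) |x - xs|^2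
                                            <= (2 l L / sigma) g(x).
   Hence the SVRG estimator at x with snapshot s has variance at most
   (4 l L / sigma) (g(x) + g(s)).

   One step: the three-point inequality of the proximal step together with
   Young's inequality gives, for eta = sigma / (25 L l),
     E[g(x_{t+1}) + |x_{t+1} - xs|^2 / (2 eta)]
       <= (g(x_t) + g(s)) / 12 + |x_t - xs|^2 / (2 eta).
   Summing over an epoch started at s, Jensen's inequality and
   m >= 4 / (sigma eta) give E[g] <= (4 + 1/m)/11 g(s) <= 3/4 g(s).

   If d = 0, then sigma <= L may fail (and eta may be sigma / 0 = 0), but then there is
   only one point. *)

(** * The Euclidean inner product *)

Section Dot.
Variables (R : realType) (d : nat).
Implicit Types (x y z : 'rV[R]_d) (a : R).

Lemma dotC x y : dot x y = dot y x.
Proof. by apply: eq_bigr => i _; rewrite mulrC. Qed.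

Lemma dotDl x y z : dot (x + y) z = dot x z + dot y z.
Proof. by rewrite /dot -big_split; apply: eq_bigr => i _; rewrite mxE mulrDl. Qed.

Lemma dotZl a x y : dot (a *: x) y = a * dot x y.
Proof. by rewrite /dot mulr_sumr; apply: eq_bigr => i _; rewrite mxE mulrA. Qed.

Lemma dotNl x y : dot (- x) y = - dot x y.
Proof. by rewrite -scaleN1r dotZl mulN1r. Qed.

Lemma dotDr x y z : dot z (x + y) = dot z x + dot z y.
Proof. by rewrite ![dot z _]dotC dotDl. Qed.

Lemma dotZr a x y : dot y (a *: x) = a * dot y x.
Proof. by rewrite ![dot y _]dotC dotZl. Qed.

Lemma dotNr x y : dot y (- x) = - dot y x.
Proof. by rewrite ![dot y _]dotC dotNl. Qed.

Definition dot_lin := (dotDl, dotDr, dotNl, dotNr, dotZl, dotZr).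

Lemma dot0l x : dot 0 x = 0.
Proof. by rewrite -(scale0r x) dotZl mul0r. Qed.

Lemma dot_suml (I : Type) (r : seq I) (P : pred I) (F : I -> 'rV[R]_d) y :
  dot (\sum_(i <- r | P i) F i) y = \sum_(i <- r | P i) dot (F i) y.
Proof. by elim/big_rec2: _ => [|i u v _ <-]; rewrite ?dotDl ?dot0l. Qed.

Lemma dot_sumr (I : Type) (r : seq I) (P : pred I) (F : I -> 'rV[R]_d) y :
  dot y (\sum_(i <- r | P i) F i) = \sum_(i <- r | P i) dot y (F i).
Proof. by rewrite dotC dot_suml; apply: eq_bigr => i _; rewrite dotC. Qed.

Lemma dot_ge0 x : 0 <= dot x x.
Proof. by apply: sumr_ge0 => i _; rewrite -expr2 sqr_ge0. Qed.

Lemma dot_subB_le x y : dot (x - y) (x - y) <= 2 * dot x x + 2 * dot y y.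
Proof. by have := dot_ge0 (x + y); rewrite !dot_lin (dotC y x); lra. Qed.

Lemma enorm_sqr x : enorm x ^+ 2 = dot x x.
Proof. by rewrite sqr_sqrtr ?dot_ge0. Qed.

Lemma sqr_coord_le_dot x i : x ord0 i ^+ 2 <= dot x x.
Proof.
rewrite /dot (bigD1 i)//= -expr2 lerDl.
by apply: sumr_ge0 => j _; rewrite -expr2 sqr_ge0.
Qed.

Lemma continuous_dotr x : continuous (fun y => dot x y).
Proof.
apply: (continuous_big (op := +%R)) => [|i _ y]; first exact: add_continuous.
by apply: continuousM; [exact: cst_continuous|exact: coord_continuous].
Qed.

Lemma continuous_dot_sub x : continuous (fun y => dot (x - y) (x - y)).
Proof.
apply: (continuous_big (op := +%R)) => [|i _ y]; first exact: add_continuous.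
have c : {for y, continuous (fun z => (x - z) ord0 i)}.
  have -> : (fun z => (x - z) ord0 i) = (fun z => x ord0 i - z ord0 i).
    by apply/funext => z; rewrite !mxE.
  by apply: continuousB; [exact: cst_continuous|exact: coord_continuous].
exact: continuousM.
Qed.

End Dot.

(** * Lower semicontinuous functions: minima on compact sets, continuous perturbations *)

Section LowerSemicontinuity.
Variables (R : realType).

(** If no minimum were attained, the sets of points [y] with [H z < H y], open by semicontinuity,
    would cover [K] as [z] ranges over [K]. In a finite subcover, the index with the smallest value
    is covered by no member. *)
Lemma lsc_compact_min (T : ptopologicalType) (H : T -> \bar R) (K : set T) :
  lower_semicontinuous H -> compact K -> (K !=set0)%classic ->
  exists2 y, K y & forall z, K z -> (H y <= H z)%E.
Proof.
move=> lscH cK [x0 Kx0]; apply: contrapT => nomin.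
have beaten y : K y -> exists2 z, K z & (H z < H y)%E.
  move=> Ky; apply: contrapT => nz; apply: nomin; exists y => // z Kz.
  by rewrite leNgt; apply/negP => zy; apply: nz; exists z.
rewrite compact_cover in cK.
have [||D sD KD] := cK T K (fun z => [set y | (H z < H y)%E])%classic.
- move=> z Kz; rewrite openE => y /= zy.
  have [a [za ay]] : exists a : R, (H z <= a%:E)%E /\ (a%:E < H y)%E.
    case: (H z) zy => [r|/lt_geF|] zy; [by exists r|by rewrite leey in zy|].
    case: (H y) zy => [s _|_|//].
      by exists (s - 1); rewrite lte_fin; split; [exact: leNye|lra].
    by exists 0; split; [exact: leNye|exact: ltry].
  have [V Vy HV] := lscH _ _ ay.
  by apply: filterS Vy => w /HV; exact: le_lt_trans.
- by move=> y Ky; have [z Kz zy] := beaten _ Ky; exists z.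
have [z0 Dz0 z0x0] := KD _ Kx0.
have [z _ zm] := Order.TotalTheory.arg_minP (fun z : D => H (val z))
  (erefl (predT (FSetSub Dz0))).
have /KD[w wD /=] : K (val z) by exact: set_mem (sD _ (valP z)).
by rewrite ltNge (zm (FSetSub wD)).
Qed.

Lemma lsc_continuousD (T : topologicalType) (q : T -> R) (h : T -> \bar R) :
  continuous q -> (forall x, h x != -oo%E) -> lower_semicontinuous h ->
  lower_semicontinuous (fun x => (q x)%:E + h x)%E.
Proof.
move=> cq hNy lsch x a ax.
(* Near [x], [h] stays above [b] and [q] above [a - b], so the sum stays above [a]. *)
have [b [ab bx]] : exists b : R, a - q x < b /\ (b%:E < h x)%E.
  move: (hNy x) ax; case: (h x) => [r _|_ _|//].
    rewrite -EFinD lte_fin => ax; exists ((a - q x + r) / 2).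
    by rewrite lte_fin; split; lra.
  by exists (a - q x + 1); rewrite ltry; split => //; lra.
have [V Vx HV] := lsch _ _ bx.
have qx : (\forall y \near x, a - b < q y)%classic.
  by apply: (cvgr_gt (q x) (cq x)); lra.
exists (V `&` [set y | a - b < q y])%classic; first exact: filterI.
move=> y [/HV by_ /= aq]; have := hNy y; move: by_.
case: (h y) => [r|_ _|//]; last by rewrite addey// ltry.
by rewrite -EFinD !lte_fin; lra.
Qed.

End LowerSemicontinuity.

(** * First-order optimality for a smooth plus a convex function *)

Section ConvexProximal.
Variables (R : realType) (d : nat) (h : 'rV[R]_d -> \bar R).
Hypotheses (proper_h : proper_fun h) (convex_h : econvex h).
Implicit Types (x y z v : 'rV[R]_d).

Lemma proper_fin_numE x : (h x \is a fin_num) = (h x < +oo)%E.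
Proof. by rewrite fin_numE proper_h.1 ltey. Qed.

Lemma econvex_fine x y (t : R) : 0 <= t <= 1 ->
  h x \is a fin_num -> h y \is a fin_num ->
  h (t *: x + (1 - t) *: y) \is a fin_num /\
  fine (h (t *: x + (1 - t) *: y)) <= t * fine (h x) + (1 - t) * fine (h y).
Proof.
move=> t01 hx hy; have := convex_h x y t01.
rewrite -{1}(fineK hx) -{1}(fineK hy) -!EFinM -EFinD => le.
have hxy : h (t *: x + (1 - t) *: y) \is a fin_num.
  by rewrite proper_fin_numE (le_lt_trans le) ?ltry.
by split=> //; rewrite -lee_fin fineK.
Qed.

Lemma le0_of_le_small (a b : R) : (forall t, 0 < t <= 1 -> a <= t * b) -> a <= 0.
Proof.
move=> ab; rewrite leNgt; apply/negP => a0.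
have a_le_b : a <= b by rewrite -[b]mul1r ab// ltr01 lexx.
have b0 : 0 < b by lra.
have := ab (a / (2 * b)); rewrite divr_gt0 ?mulr_gt0//=.
rewrite ler_pdivrMr ?mulr_gt0// (_ : a / (2 * b) * b = a / 2); last first.
  by field; rewrite gt_eqF.
by move=> /(_ ltac:(lra)); lra.
Qed.

(** Compare [z] with [z + t (x - z)]: convexity of [h] makes its change at most linear in [t], while
    the quadratic error is of order [t ^+ 2]. Divide by [t] and let it tend to 0, which is the role
    of [le0_of_le_small]. *)
Lemma first_order_optimality (q : 'rV[R]_d -> R) (M : R) v z :
  h z \is a fin_num ->
  (forall y, q y <= q z + dot v (y - z) + M * dot (y - z) (y - z)) ->
  is_minimizer (fun y => (q y)%:E + h y)%E z ->
  forall x, h x \is a fin_num -> fine (h z) - dot v (x - z) <= fine (h x).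
Proof.
move=> hz q_le zmin x hx; rewrite -subr_le0.
apply: (@le0_of_le_small _ (M * dot (x - z) (x - z))) => t t01.
have [|hxz hxz_le] := @econvex_fine x z t _ hx hz; first lra.
set w := t *: x + (1 - t) *: z in hxz hxz_le.
have := zmin w; rewrite -(fineK hz) -(fineK hxz) -!EFinD lee_fin => qz_le.
have := q_le w; have -> : w - z = t *: (x - z).
  by rewrite /w scalerBr scalerBl scale1r addrA addrAC addrK.
rewrite !(dotZl, dotZr) => qw_le; have t0 : 0 < t by lra.
by rewrite -(ler_pM2l t0); nra.
Qed.

End ConvexProximal.

(** * Existence of the proximal step and the three-point inequality *)

Section Proximal.
Variables (R : realType) (d : nat) (h : 'rV[R]_d -> \bar R).
Hypotheses (proper_h : proper_fun h) (convex_h : econvex h).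
Hypothesis (lsc_h : lower_semicontinuous h).
Variables (x0 g : 'rV[R]_d).
Hypothesis (h_x0 : h x0 \is a fin_num).
(** An affine minorant of [h] makes the proximal objective coercive. It is later supplied by
    [minorant_at_minimizer], with [x0] the minimizer of the composite objective and [g] the gradient
    of the smooth part there. *)
Hypothesis (minorant :
  forall y, h y \is a fin_num -> fine (h x0) - dot g (y - x0) <= fine (h y)).
Variables (eta : R) (x xi : 'rV[R]_d).
Hypothesis (eta_gt0 : 0 < eta).

Let prox_obj y := (((2 * eta)^-1 * enorm (x - y) ^+ 2)%:E + h y + (dot xi y)%:E)%E.
Let q y := (2 * eta)^-1 * dot (x - y) (x - y) + dot xi y.

Lemma prox_objE y : prox_obj y = ((q y)%:E + h y)%E.
Proof. by rewrite /prox_obj /q enorm_sqr EFinD addeAC. Qed.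

Lemma prox_obj_minimizer : exists y, is_minimizer prox_obj y.
Proof.
(* Completing the square in the lower bound given by the minorant shows that
   prox_obj y > prox_obj x0 as soon as |y - c|^2 > |x0 - c|^2. *)
pose c := x - eta *: (xi - g).
pose r := Num.sqrt (dot (x0 - c) (x0 - c)).
pose K := [set y : 'rV[R]_d |
  forall i, `[c ord0 i - r, c ord0 i + r]%classic (y ord0 i)]%classic.
have cK : compact K by exact: (rV_compact (fun i => @segment_compact R _ _)).
have sq_lt y : ~ K y -> dot (x0 - c) (x0 - c) < dot (y - c) (y - c).
  move=> nKy; rewrite ltNge; apply/negP => le; apply: nKy => i /=.
  have : `|(y - c) ord0 i| <= r.
    rewrite -sqrtr_sqr ler_sqrt ?dot_ge0//.
    exact: le_trans (sqr_coord_le_dot _ _) le.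
  by rewrite !mxE in_itv/= ler_norml => /andP[? ?]; apply/andP; split; lra.
have Kx0 : K x0 by apply: contrapT => /sq_lt; rewrite ltxx.
have lsc : lower_semicontinuous prox_obj.
  have -> : prox_obj = (fun y => (q y)%:E + h y)%E by apply/funext => y; exact: prox_objE.
  apply: lsc_continuousD => [y||//]; last exact: proper_h.1.
  have c1 : {for y, continuous (fun y : 'rV[R]_d => (2 * eta)^-1 * dot (x - y) (x - y))}.
    by apply: continuousM; [exact: cst_continuous|exact: continuous_dot_sub].
  by apply: cvgD c1 _; exact: continuous_dotr.
have [y Ky ymin] := lsc_compact_min lsc cK (ex_intro _ x0 Kx0).
exists y => z; have [Kz|nKz] := pselect (K z); first exact: ymin.
apply: le_trans (ymin x0 Kx0) _; rewrite !prox_objE.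
have [hz|] := boolP (h z \is a fin_num); last first.
  by rewrite proper_fin_numE// -leNgt leye_eq => /eqP ->; rewrite addey// leey.
rewrite -(fineK h_x0) -(fineK hz) -!EFinD lee_fin.
have square : (2 * eta)^-1 * (dot (z - c) (z - c) - dot (x0 - c) (x0 - c)) =
    q z - q x0 - dot g (z - x0).
  rewrite /c /q !dot_lin (dotC x g) (dotC x xi) (dotC x x0) (dotC x z).
  rewrite (dotC x0 g) (dotC x0 xi) (dotC z g) (dotC z xi) (dotC g xi).
  by field; rewrite gt_eqF.
have : 0 <= (2 * eta)^-1 * (dot (z - c) (z - c) - dot (x0 - c) (x0 - c)).
  by rewrite mulr_ge0// ?invr_ge0 ?subr_ge0 ?ltW ?sq_lt// mulr_gt0.
by rewrite square; have := minorant hz; lra.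
Qed.

(** [argmin] is a choice that returns a default point when there is no minimizer, so existence has
    to be proved first. *)
Lemma prox_step_minimizer : is_minimizer prox_obj (prox_step h eta x xi).
Proof. exact: (getPex prox_obj_minimizer). Qed.

Lemma prox_step_fin_num : h (prox_step h eta x xi) \is a fin_num.
Proof.
have := prox_step_minimizer x0; rewrite !prox_objE -(fineK h_x0) -EFinD.
rewrite proper_fin_numE// => le; rewrite ltey; apply/eqP => hoo.
by move: le; rewrite hoo addey// leye_eq.
Qed.

Lemma prox_step_three_points u : h u \is a fin_num ->
  let z := prox_step h eta x xi in
  fine (h z) + dot xi (z - u) + (2 * eta)^-1 *
    (dot (x - z) (x - z) + dot (z - u) (z - u) - dot (x - u) (x - u))
  <= fine (h u).
Proof.
move=> hu /=; set z := prox_step h eta x xi.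
have zmin : is_minimizer (fun y => (q y)%:E + h y)%E z.
  by move=> y; rewrite -!prox_objE; exact: prox_step_minimizer.
(* In fact an equality: [q] is quadratic with Hessian [eta^-1] times the identity. The final
   identity is then the polarization of [dot (z - x) (u - z)]. *)
have q_le y : q y <= q z + dot (xi + eta^-1 *: (z - x)) (y - z)
    + (2 * eta)^-1 * dot (y - z) (y - z).
  rewrite /q !dot_lin (dotC z x) (dotC y x) (dotC y z).
  by rewrite le_eqVlt; apply/orP; left; apply/eqP; field; rewrite gt_eqF.
have := first_order_optimality proper_h convex_h
  prox_step_fin_num q_le zmin hu.
apply: le_trans; rewrite le_eqVlt; apply/orP; left; apply/eqP.
rewrite !dot_lin (dotC z x) (dotC u x) (dotC u z).
by field; rewrite gt_eqF.
Qed.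

End Proximal.

(** * Real-valued uniform means, also over tuples of draws *)

Section Mean.
Variables (R : realType) (T : finType).
Implicit Types (X Y Z : T -> R).

Definition mean X : R := #|T|%:R^-1 * \sum_w X w.

Lemma eq_mean X Y : X =1 Y -> mean X = mean Y.
Proof. by move=> XY; rewrite /mean (eq_bigr Y). Qed.

Lemma meanD X Y : mean (fun w => X w + Y w) = mean X + mean Y.
Proof. by rewrite /mean big_split mulrDr. Qed.

Lemma meanZ a X : mean (fun w => a * X w) = a * mean X.
Proof. by rewrite /mean -mulr_sumr mulrCA. Qed.

Lemma meanB X Y : mean (fun w => X w - Y w) = mean X - mean Y.
Proof.
rewrite (eq_mean (Y := fun w => X w + (-1) * Y w)); last by move=> w; rewrite mulN1r.
by rewrite meanD meanZ mulN1r.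
Qed.

Lemma ler_mean X Y : (forall w, X w <= Y w) -> mean X <= mean Y.
Proof. by move=> XY; rewrite ler_wpM2l ?invr_ge0// ler_sum. Qed.

Lemma mean_le_2D X Y Z : (forall w, Z w <= 2 * X w + 2 * Y w) ->
  mean Z <= 2 * mean X + 2 * mean Y.
Proof. by rewrite -!meanZ -meanD; exact: ler_mean. Qed.

Lemma mean_cst a : (0 < #|T|)%N -> mean (fun _ => a) = a.
Proof.
by move=> T0; rewrite /mean sumr_const -[a *+ _]mulr_natl mulKf// pnatr_eq0 -lt0n.
Qed.

Lemma mean_dotl d (F : T -> 'rV[R]_d) y :
  mean (fun w => dot (F w) y) = dot (#|T|%:R^-1 *: \sum_w F w) y.
Proof. by rewrite dotZl dot_suml. Qed.

End Mean.

Section MeanTuple.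
Variables (R : realType) (T : finType) (m : nat).

Lemma big_tuple_cons (S : Type) (idx : S) (op : Monoid.com_law idx)
    (F : m.+1.-tuple T -> S) :
  \big[op/idx]_(w : m.+1.-tuple T) F w =
  \big[op/idx]_(i : T) \big[op/idx]_(w : m.-tuple T) F [tuple of i :: w].
Proof.
rewrite pair_big /=.
rewrite (reindex (fun p : T * m.-tuple T => [tuple of p.1 :: p.2]))//=.
exists (fun w => (thead w, [tuple of behead w])) => [[i w]|w] _ /=.
  by congr pair; apply/val_inj.
by rewrite [RHS]tuple_eta; apply/val_inj.
Qed.

(** Conditioning on the first draw; this drives the inductions over inner iterations and over
    epochs. *)
Lemma mean_tuple_cons (X : m.+1.-tuple T -> R) :
  mean X = mean (fun i => mean (fun w : m.-tuple T => X [tuple of i :: w])).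
Proof.
by rewrite /mean big_tuple_cons -mulr_sumr mulrA !card_tuple expnS natrM invfM.
Qed.

End MeanTuple.

(** * Smoothness of the components and variance of the gradient estimator *)

Section FiniteSum.
Variables (R : realType) (d n : nat) (f : 'I_n -> 'rV[R]_d -> R).
Hypothesis n_gt0 : (0 < n)%N.
Hypothesis diff_f : forall i x, differentiable (f i) x.
Implicit Types (x y z : 'rV[R]_d).

Local Notation fbar := (average f).

Lemma averageE x : fbar x = mean (fun i => f i x).
Proof. by rewrite /average /mean card_ord. Qed.

Lemma gradient_average x :
  gradient fbar x = n%:R^-1 *: \sum_i gradient (f i) x.
Proof.
apply/rowP => j; rewrite !mxE summxE.
have -> : fbar = n%:R^-1 \*: (\sum_i f i).
  by apply/funext => y; rewrite /average /= fct_sumE.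
have df i : derivable (f i) x (delta_mx ord0 j) by exact: diff_derivable.
rewrite deriveZ; last exact: derivable_sum.
by rewrite derive_sum//; congr (_ * _); apply: eq_bigr => i _; rewrite mxE.
Qed.

Lemma bregman_average x y : bregman fbar x y = mean (fun i => bregman (f i) x y).
Proof.
by rewrite /bregman !meanB mean_dotl card_ord -gradient_average !averageE.
Qed.

Lemma mean_gradient_dot x y : mean (fun i => dot (gradient (f i) x) y) = dot (gradient fbar x) y.
Proof. by rewrite mean_dotl card_ord gradient_average. Qed.

Lemma mean_ord_cst (a : R) : mean (fun _ : 'I_n => a) = a.
Proof. by rewrite mean_cst ?card_ord. Qed.

Definition gradient_spread x y :=
  mean (fun i => dot (gradient (f i) x - gradient (f i) y)
                     (gradient (f i) x - gradient (f i) y)).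

Variables (L l sigma : R).
Hypotheses (upper : forall i, upper_smooth L (f i)).
Hypotheses (lower : forall i, lower_smooth l (f i)).
Hypothesis strong : strongly_convex sigma fbar.

Lemma upper_smooth_average : upper_smooth L fbar.
Proof.
move=> x y; rewrite bregman_average -[leRHS]mean_ord_cst.
by apply: ler_mean => i; exact: upper.
Qed.

Hypothesis Ll_gt0 : 0 < L + l.

(* f i + l/2 |.|^2 is convex and (L + l)-smooth, hence its gradient is
   cocoercive. *)
Lemma gradient_cocoercive i x y :
  let e := gradient (f i) x - gradient (f i) y + l *: (x - y) in
  dot e e <= 2 * (L + l) * (bregman (f i) y x + l / 2 * dot (x - y) (x - y)).
Proof.
move=> /=; set gx := gradient _ x; set gy := gradient _ y.
pose e := gx - gy + l *: (x - y); rewrite -/e.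
(* [w] is a gradient step from [x] for the convexified component minus its tangent at [y]. Upper
   smoothness from [x] to [w] bounds the decrease from below; lower smoothness from [y] to [w] says
   that the value at [y] is not undercut. *)
pose w := x - (L + l)^-1 *: e.
have := upper i x w; have := lower i y w; rewrite !enorm_sqr /bregman -/gx -/gy.
have wx : w - x = - ((L + l)^-1 *: e) by rewrite /w addrAC subrr sub0r.
have wy : w - y = (x - y) - (L + l)^-1 *: e by rewrite /w addrAC.
rewrite wx wy; set u := x - y.
have ee : dot e e = dot gx e - dot gy e + l * dot u e.
  by rewrite {1}/e -/u !dot_lin.
clearbody e u; rewrite !dot_lin (dotC e u) => lo up.
have key : 0 <= f i x - f i y - dot gy u + l / 2 * dot u u - dot e e / (2 * (L + l)).
  have id : dot e e / (2 * (L + l)) =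
      (L + l)^-1 * (dot gx e - dot gy e + l * dot u e)
      - (L + l) / 2 * ((L + l)^-1 * ((L + l)^-1 * dot e e)).
    by rewrite -ee; field; rewrite gt_eqF.
  by rewrite id; lra.
rewrite subr_ge0 ler_pdivrMr ?mulr_gt0// in key.
by apply: le_trans key _; rewrite mulrC.
Qed.

Lemma bregman_sym x y :
  bregman fbar x y + bregman fbar y x = dot (gradient fbar y - gradient fbar x) (y - x).
Proof. by rewrite /bregman !dot_lin; ring. Qed.

Lemma gradient_spread_le x y : 0 <= l ->
  gradient_spread x y <= 2 * L * bregman fbar y x + l * (L - sigma) * dot (x - y) (x - y).
Proof.
move=> l0; set A := gradient_spread x y; set E := dot (x - y) (x - y).
have : A + 2 * l * dot (gradient fbar x - gradient fbar y) (x - y) + l ^+ 2 * E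
    <= 2 * (L + l) * (bregman fbar y x + l / 2 * E).
  rewrite /A /gradient_spread dotDl dotNl -!mean_gradient_dot bregman_average.
  rewrite -[l ^+ 2 * E]mean_ord_cst -[l / 2 * E]mean_ord_cst -meanB -meanD -!meanZ -!meanD.
  apply: ler_mean => i; apply: le_trans (gradient_cocoercive i x y).
  set gx := gradient _ x; set gy := gradient _ y; rewrite /E !dot_lin.
  rewrite (dotC x gx) (dotC x gy) (dotC y gx) (dotC y gy).
  by rewrite le_eqVlt; apply/orP; left; apply/eqP; ring.
(* The cross term is [2 * l] times both Bregman divergences: one lowers the coefficient
   [2 * (L + l)] to [2 * L], the other is bounded below by strong convexity. *)
rewrite -bregman_sym; have := strong x y; rewrite enorm_sqr.
have -> : dot (y - x) (y - x) = E by rewrite -(opprB x y) dotNl dotNr opprK.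
by move=> st; nra.
Qed.

Lemma mean_sqr_centered (F : 'I_n -> 'rV[R]_d) :
  let c := n%:R^-1 *: \sum_i F i in
  mean (fun i => dot (c - F i) (c - F i)) <= mean (fun i => dot (F i) (F i)).
Proof.
move=> /=; set c := _ *: _.
have -> : mean (fun i => dot (c - F i) (c - F i)) =
    mean (fun i => dot c c - 2 * dot (F i) c + dot (F i) (F i)).
  by apply: eq_mean => i; rewrite dotDl !dotDr !dotNl !dotNr (dotC c (F i)); ring.
rewrite meanD meanB meanZ mean_ord_cst mean_dotl card_ord -/c.
by have := dot_ge0 c; lra.
Qed.

Definition svrg_gradient s x i :=
  gradient (f i) x - gradient (f i) s + gradient fbar s.

(** The error is a difference of two centred variables, one for [x] and one for the snapshot [s],
    both measured relative to [y]. Centring does not increase the mean square. *)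
Lemma mean_sqr_svrg_gradient s x y :
  mean (fun i => dot (gradient fbar x - svrg_gradient s x i)
                     (gradient fbar x - svrg_gradient s x i))
  <= 2 * gradient_spread x y + 2 * gradient_spread s y.
Proof.
pose a z i := gradient (f i) z - gradient (f i) y.
pose c z := n%:R^-1 *: \sum_i a z i.
have le z : 2 * mean (fun i => dot (c z - a z i) (c z - a z i)) <=
    2 * gradient_spread z y.
  by rewrite ler_wpM2l//; exact: mean_sqr_centered.
apply: le_trans (lerD (le x) (le s)); apply: mean_le_2D => i.
have -> : gradient fbar x - svrg_gradient s x i = (c x - a x i) - (c s - a s i).
  rewrite /svrg_gradient !gradient_average /c /a !sumrB !scalerBr.
  by apply/rowP => j; rewrite !mxE; ring.
exact: dot_subB_le.
Qed.

End FiniteSum.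

(** Induction on the list: the mean of [k + 1] points is the convex combination of the head, with
    weight [(k + 1)^-1], and the mean of the tail. *)
Lemma econvex_jensen (R : realType) (d : nat) (h : 'rV[R]_d -> \bar R)
    (ys : seq 'rV[R]_d) :
  proper_fun h -> econvex h -> (0 < size ys)%N ->
  (forall y, y \in ys -> h y \is a fin_num) ->
  let c := (size ys)%:R^-1 *: \sum_(y <- ys) y in
  h c \is a fin_num /\ (size ys)%:R * fine (h c) <= \sum_(y <- ys) fine (h y).
Proof.
move=> proper_h convex_h; elim: ys => // y [_ _ hys|z ys].
  by rewrite /= !big_seq1 invr1 scale1r mul1r hys// mem_head.
set zs := z :: ys => IH _ hys.
have [//||hc hc_le] := IH; first by move=> w ws; rewrite hys// inE ws orbT.
have hy : h y \is a fin_num by rewrite hys// mem_head.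
rewrite !(big_cons _ _ y) [size (y :: _)]/= -/zs.
have k0 : 0 < (size zs)%:R :> R by rewrite ltr0n.
move: hc hc_le; set k := (size zs)%:R in k0 *; set c := k^-1 *: _ => hc hc_le.
have -> : (size zs).+1%:R = k + 1 by rewrite -natr1.
have t01 : 0 <= (k + 1)^-1 <= 1.
  by rewrite invr_ge0 invf_le1; [apply/andP; split; lra|lra].
have [hyc hyc_le] := econvex_fine proper_h convex_h t01 hy hc.
have e : (k + 1)^-1 *: (y + \sum_(w <- zs) w) = (k + 1)^-1 *: y + (1 - (k + 1)^-1) *: c.
  rewrite /c scalerDr scalerA; congr (_ + _ *: _).
  by field; rewrite !gt_eqF//; lra.
rewrite e; split=> //.
rewrite -(ler_pM2l (_ : 0 < k + 1)) in hyc_le; last lra.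
apply: le_trans hyc_le _; rewrite mulrDr mulrA mulfV ?mul1r; last by rewrite gt_eqF//; lra.
rewrite lerD2l mulrA (_ : (k + 1) * (1 - (k + 1)^-1) = k)//.
by field; rewrite gt_eqF//; lra.
Qed.

Lemma svrg_gradient_unbiased (R : realType) (d n : nat) (f : 'I_n -> 'rV[R]_d -> R) s x :
  (0 < n)%N -> (forall i x, differentiable (f i) x) ->
  n%:R^-1 *: \sum_i svrg_gradient f s x i = gradient (average f) x.
Proof.
move=> n_gt0 diff_f; rewrite big_split sumrB /= sumr_const card_ord.
rewrite scalerDr scalerBr -!gradient_average// -[gradient _ s *+ n]scaler_nat scalerA mulVf.
  by rewrite scale1r subrK.
by rewrite pnatr_eq0 -lt0n.
Qed.

(** * The composite objective near its minimizer *)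

Section Composite.
Variables (R : realType) (d n : nat).
Variables (f : 'I_n -> 'rV[R]_d -> R) (Psi : 'rV[R]_d -> \bar R).
Variables (L l sigma : R) (xs : 'rV[R]_d).
Hypothesis n_gt0 : (0 < n)%N.
Hypothesis diff_f : forall i x, differentiable (f i) x.
Hypotheses (proper_Psi : proper_fun Psi) (convex_Psi : econvex Psi).
Hypothesis lsc_Psi : lower_semicontinuous Psi.
Hypothesis xs_min : is_minimizer (objective f Psi) xs.
Hypotheses (sigma_gt0 : 0 < sigma) (sigma_le_L : sigma <= L) (L_le_l : L <= l).
Hypothesis upper : forall i, upper_smooth L (f i).
Hypothesis lower : forall i, lower_smooth l (f i).
Hypothesis strong : strongly_convex sigma (average f).

Local Notation fbar := (average f).
Let eta := sigma / (25 * L * l).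
Let L_gt0 : 0 < L. Proof. exact: lt_le_trans sigma_gt0 sigma_le_L. Qed.
Let l_gt0 : 0 < l. Proof. exact: lt_le_trans L_gt0 L_le_l. Qed.
Let eta_gt0 : 0 < eta.
Proof. by rewrite divr_gt0 ?mulr_gt0. Qed.

Lemma minimizer_fin_num : Psi xs \is a fin_num.
Proof.
have [x Psix] := proper_Psi.2; have := xs_min x.
rewrite /objective -(fineK Psix) -EFinD proper_fin_numE// => le.
by rewrite ltey; apply/eqP => oo; move: le; rewrite oo addey// leye_eq.
Qed.

(** Real-valued, to allow real arithmetic. Where [Psi] is [+oo], [fine] returns 0 and this is not
    the true gap, hence the finiteness hypotheses below. *)
Definition objective_gap x := fbar x + fine (Psi x) - (fbar xs + fine (Psi xs)).

Lemma objective_gapE x : Psi x \is a fin_num ->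
  (objective f Psi x - objective f Psi xs)%E = (objective_gap x)%:E.
Proof.
move=> Psix; rewrite /objective -(fineK Psix) -(fineK minimizer_fin_num).
by rewrite -!EFinD.
Qed.

Lemma minorant_at_minimizer x : Psi x \is a fin_num ->
  fine (Psi xs) - dot (gradient fbar xs) (x - xs) <= fine (Psi x).
Proof.
apply: (@first_order_optimality _ _ _ proper_Psi convex_Psi fbar (L / 2)) => //.
  exact: minimizer_fin_num.
move=> y; have := upper_smooth_average n_gt0 diff_f upper xs y.
by rewrite /bregman enorm_sqr; lra.
Qed.

Lemma bregman_le_gap x : Psi x \is a fin_num -> bregman fbar xs x <= objective_gap x.
Proof. by move=> /minorant_at_minimizer; rewrite /bregman /objective_gap; lra. Qed.

Lemma quadratic_growth x : Psi x \is a fin_num ->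
  sigma / 2 * dot (x - xs) (x - xs) <= objective_gap x.
Proof.
move=> Psix; apply: le_trans (bregman_le_gap Psix).
by rewrite -enorm_sqr; exact: strong.
Qed.

Lemma gap_ge0 x : Psi x \is a fin_num -> 0 <= objective_gap x.
Proof.
move=> Psix; apply: le_trans (quadratic_growth Psix).
by rewrite mulr_ge0 ?dot_ge0// divr_ge0 ?ltW.
Qed.

Lemma gradient_spread_le_gap x : Psi x \is a fin_num ->
  gradient_spread f x xs <= 2 * (L * l / sigma) * objective_gap x.
Proof.
move=> Psix; have := gradient_spread_le n_gt0 diff_f upper lower strong.
move=> /(_ (addr_gt0 L_gt0 l_gt0) x xs (ltW l_gt0)) /le_trans; apply.
have gr : dot (x - xs) (x - xs) <= 2 / sigma * bregman fbar xs x.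
  have := strong xs x; rewrite enorm_sqr; set E := dot _ _; set B := bregman _ _ _.
  move=> le; have -> : E = 2 / sigma * (sigma / 2 * E) by field; rewrite gt_eqF.
  by rewrite ler_wpM2l// divr_ge0 ?ltW.
have B0 : 0 <= bregman fbar xs x.
  by apply: le_trans (strong xs x); rewrite mulr_ge0 ?sqr_ge0// divr_ge0 ?ltW.
apply: le_trans (_ : 2 * (L * l / sigma) * bregman fbar xs x <= _); last first.
  by rewrite ler_wpM2l ?bregman_le_gap// mulr_ge0// divr_ge0 ?mulr_ge0 ?ltW.
have : l * (L - sigma) * dot (x - xs) (x - xs) <=
    l * (L - sigma) * (2 / sigma * bregman fbar xs x).
  by rewrite ler_wpM2l// mulr_ge0 ?subr_ge0// ltW.
move: (bregman _ _ _) (dot _ _) B0 => B E B0.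
(* The negative term [2 * l * B] pays for [2 * L * B], since [L <= l]. *)
have -> : l * (L - sigma) * (2 / sigma * B) = 2 * (L * l / sigma) * B - 2 * l * B.
  by field; rewrite gt_eqF.
by move: L_le_l; nra.
Qed.

(** * One proximal step *)

Let eta_L : eta * L <= 25^-1.
Proof.
have -> : eta * L = sigma / l * 25^-1.
  by rewrite /eta; field; rewrite !gt_eqF.
rewrite ler_piMl// ler_pdivrMr// mul1r.
exact: le_trans sigma_le_L L_le_l.
Qed.

Lemma prox_step_Psi_fin_num x xi : Psi (prox_step Psi eta x xi) \is a fin_num.
Proof.
exact: (prox_step_fin_num proper_Psi lsc_Psi minimizer_fin_num
  minorant_at_minimizer x xi eta_gt0).
Qed.

(** Sum of the three-point inequality at [xs], upper smoothness from [x] to [z] and convexity from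
    [x] to [xs]. The gradient error [e] is paired with [z - x], which Young's inequality handles,
    and with [x - xs], which is kept because it averages to zero. *)
Lemma prox_step_gap_le x xi : Psi x \is a fin_num ->
  let z := prox_step Psi eta x xi in let e := gradient fbar x - xi in
  objective_gap z + (2 * eta)^-1 * dot (z - xs) (z - xs) <=
  25 / 48 * eta * dot e e + dot e (x - xs) + (2 * eta)^-1 * dot (x - xs) (x - xs).
Proof.
move=> Psix /=; set z := prox_step _ _ _ _; set e := gradient fbar x - xi.
have := prox_step_three_points proper_Psi convex_Psi lsc_Psi minimizer_fin_num
  minorant_at_minimizer x xi eta_gt0 minimizer_fin_num.
rewrite /= -/z => three.
have up := upper_smooth_average n_gt0 diff_f upper x z.
have lo : 0 <= bregman fbar x xs.
  by apply: le_trans (strong x xs); rewrite mulr_ge0 ?sqr_ge0// divr_ge0 ?ltW.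
have split_e : dot (gradient fbar x) (z - x) - dot (gradient fbar x) (xs - x)
    - dot xi (z - xs) = dot e (z - x) + dot e (x - xs).
  by rewrite /e !dot_lin; ring.
clearbody e.
(* Young's inequality, weighted so that |z - x|^2 / (50 eta) is left over to absorb
   the smoothness term L/2 |z - x|^2. *)
have young : dot e (z - x) <= 25 / 48 * eta * dot e e
    + (1 - 25^-1) * (2 * eta)^-1 * dot (z - x) (z - x).
  have := dot_ge0 (e - (24 / (25 * eta)) *: (z - x)).
  move: (z - x) => w; rewrite !dot_lin (dotC w e) => sq.
  rewrite -subr_ge0; move: (mulr_ge0 (ltW eta_gt0) sq).
  move: (dot e e) (dot e w) (dot w w) => ee ew ww sq'.
  have -> : 25 / 48 * eta * ee + (1 - 25^-1) * (2 * eta)^-1 * ww - ew =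
    25 / 48 * (eta * (ee + - (24 / (25 * eta) * ew) +
      (- (24 / (25 * eta) * ew) + - - (24 / (25 * eta) * (24 / (25 * eta) * ww))))).
    by field; rewrite gt_eqF.
  by rewrite mulr_ge0.
have L_le : L / 2 * dot (z - x) (z - x) <= 25^-1 * (2 * eta)^-1 * dot (z - x) (z - x).
  rewrite ler_wpM2r ?dot_ge0// invfM mulrCA mulrC ler_wpM2l//.
  by rewrite ler_pdivlMr// mulrC.
have xz : dot (x - z) (x - z) = dot (z - x) (z - x).
  by rewrite -(opprB z x) dotNl dotNr opprK.
rewrite xz in three; rewrite /bregman enorm_sqr in up lo *; rewrite /objective_gap.
move: three up lo split_e young L_le; rewrite /bregman.
move: (dot (z - x) (z - x)) (dot (z - xs) (z - xs)) (dot (x - xs) (x - xs)).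
move: (dot xi _) (dot _ (z - x)) (dot _ (xs - x)).
move: (dot e (z - x)) (dot e (x - xs)) (dot e e).
move: (fbar x) (fbar z) (fbar xs) (fine (Psi z)) (fine (Psi xs)) => *.
by lra.
Qed.

Lemma mean_prox_step_le s x : Psi s \is a fin_num -> Psi x \is a fin_num ->
  let z i := prox_step Psi eta x (svrg_gradient f s x i) in
  mean (fun i => objective_gap (z i) + (2 * eta)^-1 * dot (z i - xs) (z i - xs)) <=
  12^-1 * (objective_gap x + objective_gap s) + (2 * eta)^-1 * dot (x - xs) (x - xs).
Proof.
move=> Psis Psix /=; set e := fun i => gradient fbar x - svrg_gradient f s x i.
have mean_e : mean (fun i => dot (e i) (x - xs)) = 0.
  rewrite mean_dotl card_ord sumrB sumr_const card_ord scalerBr.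
  rewrite svrg_gradient_unbiased// -[gradient _ x *+ n]scaler_nat scalerA mulVf.
    by rewrite scale1r subrr dot0l.
  by rewrite pnatr_eq0 -lt0n.
apply: le_trans (ler_mean (fun i => prox_step_gap_le (svrg_gradient f s x i) Psix)) _.
rewrite 2!meanD mean_e addr0 mean_ord_cst// lerD2r meanZ.
have var := mean_sqr_svrg_gradient n_gt0 diff_f s x xs.
apply: le_trans (_ : 25 / 48 * eta *
    (2 * gradient_spread f x xs + 2 * gradient_spread f s xs) <= _).
  by apply: ler_wpM2l; [rewrite mulr_ge0// ltW|exact: var].
apply: le_trans (_ : 25 / 48 * eta * (2 * (2 * (L * l / sigma) * objective_gap x)
    + 2 * (2 * (L * l / sigma) * objective_gap s)) <= _).
  apply: ler_wpM2l; first by rewrite mulr_ge0// ltW.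
  by apply: lerD; apply: ler_wpM2l => //; exact: gradient_spread_le_gap.
(* With this [eta], the coefficient of each gap is [25 / 48 * eta * 4 * (L * l / sigma)], that is
   1/12. *)
by rewrite le_eqVlt /eta; apply/orP; left; apply/eqP; field; rewrite !gt_eqF.
Qed.

(** * One epoch *)

Definition iterates s x (w : seq 'I_n) : seq 'rV[R]_d :=
  value (inner_loop f Psi eta s (gradient fbar s) x w).

Lemma iterates_cons s x i w :
  let z := prox_step Psi eta x (svrg_gradient f s x i) in
  iterates s x (i :: w) = z :: iterates s z w.
Proof. by []. Qed.

Lemma size_iterates s x w : size (iterates s x w) = size w.
Proof. by elim: w x => // i w IH x; rewrite iterates_cons /= IH. Qed.

Lemma iterates_fin_num s x w y : y \in iterates s x w -> Psi y \is a fin_num.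
Proof.
elim: w x => // i w IH x; rewrite iterates_cons inE => /orP[/eqP ->|/IH //].
exact: prox_step_Psi_fin_num.
Qed.

(** The one-step bound telescopes. An iterate's gap has coefficient 1 on the left in its own step
    and 1/12 on the right in the next, which leaves 11/12. The start [x] is separate from the
    snapshot [s] because the induction moves it. *)
Lemma mean_iterates_le m s x : Psi s \is a fin_num -> Psi x \is a fin_num ->
  11 / 12 * mean (fun w : m.-tuple 'I_n => \sum_(y <- iterates s x w) objective_gap y) <=
  12^-1 * objective_gap x + m%:R / 12 * objective_gap s + (2 * eta)^-1 * dot (x - xs) (x - xs).
Proof.
move=> Psis; elim: m x => [|m IH] x Psix.
  rewrite /mean big1 ?mulr0; last by move=> w _; rewrite tuple0 /= big_nil.
  have := gap_ge0 Psix; have : 0 <= (2 * eta)^-1 * dot (x - xs) (x - xs).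
    by rewrite mulr_ge0 ?dot_ge0// invr_ge0 mulr_ge0// ltW.
  by move: (_ * dot _ _) (objective_gap x) => u v; lra.
pose z i := prox_step Psi eta x (svrg_gradient f s x i).
have Psiz i : Psi (z i) \is a fin_num by exact: prox_step_Psi_fin_num.
rewrite mean_tuple_cons -meanZ.
apply: le_trans (_ : mean (fun i =>
    (objective_gap (z i) + (2 * eta)^-1 * dot (z i - xs) (z i - xs))
    + m%:R / 12 * objective_gap s) <= _).
  apply: ler_mean => i.
  rewrite (@eq_mean _ _ _ (fun w : m.-tuple 'I_n =>
      objective_gap (z i) + \sum_(y <- iterates s (z i) w) objective_gap y)).
    rewrite meanD mean_cst ?card_tuple ?expn_gt0 ?card_ord ?n_gt0//.
    have := IH (z i) (Psiz i).
    move: (mean _) (_ * dot _ _) (objective_gap (z i)) (_ * objective_gap s).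
    by move=> a b c e; lra.
  by move=> w; rewrite iterates_cons big_cons.
rewrite meanD mean_ord_cst//.
apply: le_trans (lerD (mean_prox_step_le Psis Psix) (lexx _)) _.
rewrite -[m.+1%:R]natr1; move: (_ * dot _ _) (objective_gap x) (objective_gap s) => a b c.
by move: (m%:R : R) => k; lra.
Qed.

Lemma epochE m s (w : m.-tuple 'I_n) :
  value (epoch f Psi eta s w) = m%:R^-1 *: \sum_(y <- iterates s s w) y.
Proof. by []. Qed.

Lemma epoch_gap_le m s (w : m.-tuple 'I_n) : (0 < m)%N ->
  Psi (value (epoch f Psi eta s w)) \is a fin_num /\
  m%:R * objective_gap (value (epoch f Psi eta s w)) <=
  \sum_(y <- iterates s s w) objective_gap y.
Proof.
move=> m_gt0; rewrite epochE; set ys := iterates s s w.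
have sz : size ys = m by rewrite size_iterates size_tuple.
have [||] := @econvex_jensen _ _ _ ys proper_Psi convex_Psi; rewrite ?sz//.
  by move=> y; exact: iterates_fin_num.
set c := _ *: _ => Psic le; split=> //.
have sum_const (a : R) : \sum_(y <- ys) a = m%:R * a.
  by rewrite big_const_seq count_predT sz iter_addr_0 mulr_natl.
rewrite /objective_gap big_split sumrN big_split /= !sum_const mulrBr mulrDr.
rewrite lerB// lerD//.
(* Jensen for the smooth part: sum the tangent inequalities at the mean [c], whose linear terms
   cancel. *)
have : \sum_(y <- ys) (fbar c + dot (gradient fbar c) (y - c)) <= \sum_(y <- ys) fbar y.
  apply: ler_sum => y _; have := strong c y; rewrite /bregman.
  have : 0 <= sigma / 2 * enorm (y - c) ^+ 2.
    by rewrite mulr_ge0 ?sqr_ge0// divr_ge0 ?ltW.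
  by move: (_ * enorm _ ^+ 2) (fbar c) (fbar y) (dot _ _) => *; lra.
rewrite big_split /= sum_const -dot_sumr sumrB big_const_seq count_predT sz.
rewrite iter_addr_0 -[c *+ m]scaler_nat {2}/c scalerA mulfV ?scale1r ?subrr.
  by rewrite dotC dot0l addr0.
by rewrite pnatr_eq0 -lt0n.
Qed.

Lemma epoch_length_gt0 m : 4 / (sigma * eta) <= m%:R -> (0 < m)%N.
Proof.
move=> m_ge; rewrite -(ltr0n R); apply: lt_le_trans m_ge.
by rewrite divr_gt0// mulr_gt0.
Qed.

Lemma mean_epoch_gap_le m s : 4 / (sigma * eta) <= m%:R -> Psi s \is a fin_num ->
  mean (fun w : m.-tuple 'I_n => objective_gap (value (epoch f Psi eta s w)))
  <= 3 / 4 * objective_gap s.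
Proof.
move=> m_ge Psis; have m_gt0 := epoch_length_gt0 m_ge.
have m1 : 1 <= m%:R :> R by rewrite ler1n.
have start : (2 * eta)^-1 * dot (s - xs) (s - xs) <= m%:R / 4 * objective_gap s.
  apply: le_trans (_ : (sigma * eta)^-1 * objective_gap s <= _).
    have -> : (2 * eta)^-1 * dot (s - xs) (s - xs) =
        (sigma * eta)^-1 * (sigma / 2 * dot (s - xs) (s - xs)).
      by field; rewrite !gt_eqF.
    by rewrite ler_wpM2l ?quadratic_growth// invr_ge0 ltW// mulr_gt0.
  by rewrite ler_wpM2r ?gap_ge0// ler_pdivlMr// mulrC.
have sum_le := mean_iterates_le m Psis Psis.
have avg : m%:R * mean (fun w : m.-tuple 'I_n => objective_gap (value (epoch f Psi eta s w)))
    <= mean (fun w : m.-tuple 'I_n => \sum_(y <- iterates s s w) objective_gap y).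
  by rewrite -meanZ; apply: ler_mean => w; have [] := epoch_gap_le s w m_gt0.
have g0 := gap_ge0 Psis; rewrite -(ler_pM2l (_ : 0 < m%:R)) ?ltr0n//.
(* With [1 <= m], the right-hand side is at most 1/12 + 1/12 + 1/4 = 5/12 of [m] times the gap, so
   the ratio is at most 5/11. *)
have : 1 * objective_gap s <= m%:R * objective_gap s by rewrite ler_wpM2r.
move: avg sum_le start g0; move: (mean _) (mean _) (_ * dot _ _) => a b c; nra.
Qed.

(** * Whole runs and extended-real expectations *)

Lemma svrg_fin_num m x (ws : seq (m.-tuple 'I_n)) : (0 < m)%N ->
  Psi x \is a fin_num -> Psi (value (svrg f Psi eta x ws)) \is a fin_num.
Proof.
move=> m_gt0; elim: ws x => // w ws IH x Psix.
by apply: IH; have [] := epoch_gap_le x w m_gt0.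
Qed.

Lemma mean_svrg_gap_le S m x : 4 / (sigma * eta) <= m%:R -> Psi x \is a fin_num ->
  mean (fun ws : S.-tuple (m.-tuple 'I_n) => objective_gap (value (svrg f Psi eta x ws)))
  <= (3 / 4) ^+ S * objective_gap x.
Proof.
move=> m_ge; elim: S x => [|S IH] x Psix.
  rewrite (@eq_mean _ _ _ (fun _ => objective_gap x)); last by move=> ws; rewrite tuple0.
  by rewrite mean_cst ?card_tuple// mul1r.
rewrite mean_tuple_cons.
apply: le_trans (_ : mean (fun w : m.-tuple 'I_n =>
   (3 / 4) ^+ S * objective_gap (value (epoch f Psi eta x w))) <= _).
  apply: ler_mean => w; apply: IH.
  by have [] := epoch_gap_le x w (epoch_length_gt0 m_ge).
by rewrite meanZ exprSr -mulrA ler_wpM2l ?exprn_ge0// mean_epoch_gap_le.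
Qed.

Lemma uniform_expectation_gap (T : finType) (X : T -> 'rV[R]_d) :
  (forall w, Psi (X w) \is a fin_num) ->
  uniform_expectation (fun w => objective f Psi (X w) - objective f Psi xs)%E =
  (mean (fun w => objective_gap (X w)))%:E.
Proof.
move=> PsiX; rewrite /uniform_expectation (eq_bigr (fun w => (objective_gap (X w))%:E)).
  by rewrite sumEFin -EFinM.
by move=> w _; exact: objective_gapE.
Qed.

Lemma uniform_expectation_epoch_le m x : 4 / (sigma * eta) <= m%:R ->
  (uniform_expectation (fun w : m.-tuple 'I_n =>
     objective f Psi (value (epoch f Psi eta x w)) - objective f Psi xs)
   <= (3 / 4)%:E * (objective f Psi x - objective f Psi xs))%E.
Proof.
move=> m_ge; have m_gt0 := epoch_length_gt0 m_ge.
rewrite uniform_expectation_gap; last by move=> w; have [] := epoch_gap_le x w m_gt0.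
have [Psix|] := boolP (Psi x \is a fin_num).
  by rewrite objective_gapE// -EFinM lee_fin mean_epoch_gap_le.
(* A start outside the domain of [Psi] makes the right-hand side [+oo]. *)
rewrite proper_fin_numE// -leNgt leye_eq /objective => /eqP ->.
rewrite addey// -(fineK minimizer_fin_num) -EFinD addye//.
by rewrite mulry gtr0_sg// mul1e leey.
Qed.

End Composite.

(** * Appending an epoch, and counting gradient evaluations *)

Section SvrgRuns.
Variables (R : realType) (d n m : nat) (f : 'I_n -> 'rV[R]_d -> R).
Variables (Psi : 'rV[R]_d -> \bar R) (eta : R).

(** [svrg] recurses on the first epoch, whereas the per-epoch claim appends one to a fixed
    history. *)
Lemma svrg_rcons x (ws : seq (m.-tuple 'I_n)) w :
  value (svrg f Psi eta x (rcons ws w)) =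
  value (epoch f Psi eta (value (svrg f Psi eta x ws)) w).
Proof. by elim: ws x => // v ws IH x; exact: IH. Qed.

Lemma cost_bind (A B : Type) (c : counted A) (k : A -> counted B) :
  cost (bind c k) = (cost c + cost (k (value c)))%N.
Proof. by []. Qed.

Lemma inner_loop_cost s mu x w : cost (inner_loop f Psi eta s mu x w) = (2 * size w)%N.
Proof.
by elim: w x => // i w IH x; rewrite [inner_loop _ _ _ _ _ _ _]/= !cost_bind IH /cost/=; lia.
Qed.

(** Each epoch spends [n] evaluations on the snapshot and two per inner iteration. *)
Lemma svrg_cost x (ws : seq (m.-tuple 'I_n)) :
  cost (svrg f Psi eta x ws) = (size ws * (n + 2 * m))%N.
Proof.
elim: ws x => // w ws IH x; rewrite [svrg _ _ _ _ _]/= cost_bind IH /epoch.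
by rewrite !cost_bind inner_loop_cost size_tuple /cost /=; lia.
Qed.

End SvrgRuns.

(** * Comparison of constants, rounding and logarithms *)

Lemma smoothness_ge_strong_convexity (R : realType) (d : nat) (g : 'rV[R]_d -> R) L sigma :
  (0 < d)%N -> upper_smooth L g -> strongly_convex sigma g -> sigma <= L.
Proof.
move=> d_gt0 up st; pose e : 'rV[R]_d := const_mx 1.
have := le_trans (st 0 e) (up 0 e); rewrite subr0 enorm_sqr.
have e0 : 0 < dot e e.
  apply: lt_le_trans (sqr_coord_le_dot e (Ordinal d_gt0)).
  by rewrite mxE expr1n.
by rewrite ler_pM2r//; lra.
Qed.

Lemma le_nat_ceil (R : realType) (x : R) : x <= (nat_ceil x)%:R.
Proof.
rewrite /nat_ceil -[_%:R]/((Posz `|_|%N)%:~R) gez0_abs ?le_max ?lexx//.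
apply: le_trans (ceil_ge x) _; rewrite ler_int le_max lexx orbT //.
Qed.

Lemma nat_ceil_le (R : realType) (x : R) : 0 <= x -> (nat_ceil x)%:R <= x + 1.
Proof.
move=> x0; rewrite /nat_ceil -[_%:R]/((Posz `|_|%N)%:~R) gez0_abs ?le_max ?lexx//.
rewrite max_r ?ceil_ge0//; last by apply: lt_le_trans x0; rewrite ltrN10.
by have := ceil_itv x; rewrite intrB => /andP[]; lra.
Qed.

Lemma expr_log43_le (R : realType) (r : R) : 0 <= r ->
  (3 / 4) ^+ nat_ceil (log43 r) * r <= 1.
Proof.
(* The comparison of logarithms needs [0 < r], so [r = 0] is separate. *)
rewrite le_eqVlt => /orP[/eqP <-|r0]; first by rewrite mulr0.
set S := nat_ceil _.
have q0 : 0 < 4 / 3 :> R by [].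
have lnq : 0 < ln (4 / 3 : R) by rewrite ln_gt0//; lra.
have : r <= (4 / 3) ^+ S.
  rewrite -ler_ln ?posrE ?exprn_gt0// lnXn// -[ln _ *+ S]mulr_natl -ler_pdivrMr//.
  exact: le_nat_ceil.
have -> : 3 / 4 = (4 / 3)^-1 :> R by rewrite invf_div.
by rewrite exprVn ler_pdivrMl ?exprn_gt0// mulr1.
Qed.

(** Valid also for zero parameters, as the inverse of 0 is 0; the case [d = 0] relies on this. *)
Lemma epoch_length_eq (R : realType) (L l sigma : R) :
  4 / (sigma * (sigma / (25 * L * l))) = 100 * (L * l / sigma ^+ 2).
Proof. by rewrite expr2 !invfM !invrK; ring. Qed.

Theorem theorem6p1 (R : realType) :
  exists (c : R) (C : R -> R), 0 < c /\
  forall (d n : nat) (f : 'I_n -> 'rV[R]_d -> R) (Psi : 'rV[R]_d -> \bar R)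
    (L l sigma : R) (xphi xstar : 'rV[R]_d),
  (0 < n)%N ->
  (forall i x, differentiable (f i) x) ->
  proper_fun Psi -> econvex Psi -> lower_semicontinuous Psi ->
  is_minimizer (objective f Psi) xstar ->
  0 <= L -> L <= l -> 0 < sigma ->
  (forall i, upper_smooth L (f i)) ->
  (forall i, lower_smooth l (f i)) ->
  strongly_convex sigma (average f) ->
  let F := objective f Psi in
  let eta := sigma / (25 * L * l) in
  [/\ c * (L * l / sigma ^+ 2) <= 4 / (sigma * eta),
      forall (m : nat), 4 / (sigma * eta) <= m%:R ->
        forall (s : nat) (h : s.-tuple (m.-tuple 'I_n)),
        (uniform_expectation (fun w : m.-tuple 'I_n =>
           F (value (svrg f Psi eta xphi (rcons h w))) - F xstar)
         <= (3 / 4)%:E * (F (value (svrg f Psi eta xphi h)) - F xstar))%E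
    & forall eps : R, 0 < eps -> F xphi \is a fin_num ->
        let gap := fine (F xphi - F xstar)%E in
        let S := nat_ceil (log43 (gap / eps)) in
        (forall m : nat, 4 / (sigma * eta) <= m%:R ->
           (uniform_expectation (fun ws : S.-tuple (m.-tuple 'I_n) =>
              F (value (svrg f Psi eta xphi ws)) - F xstar) <= eps%:E)%E)
        /\
        (forall rho : R, 1 < rho -> rho <= gap / eps ->
           let m := nat_ceil (4 / (sigma * eta)) in
           forall ws : S.-tuple (m.-tuple 'I_n),
             (cost (svrg f Psi eta xphi ws))%:R
             <= C rho * (n%:R + L * l / sigma ^+ 2) * ln (gap / eps))].
Proof.
(* 100 comes from [epoch_length_eq]. Rounding gives [m <= 101 * kappa], so an epoch costs at most
   [n + 202 * kappa]. The two inverse logarithms come from [log43] and from rounding up [S], as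
   [1 <= ln r / ln rho]. *)
exists 100, (fun rho => 202 * ((ln (4 / 3))^-1 + (ln rho)^-1)); split=> //.
move=> d n f Psi L l sigma xphi xstar n_gt0 diff_f proper_Psi convex_Psi lsc_Psi.
move=> xs_min L0 L_le_l sigma_gt0 upper lower strong F eta.
have [d0|d_gt0] := posnP d.
  subst d; have all_eq (x y : 'rV[R]_0) : x = y by rewrite [x]thinmx0 [y]thinmx0.
  have F_eq x : (F x - F xstar)%E = 0%E.
    rewrite (all_eq x xstar) subee// /F /objective fin_numD /=.
    exact: minimizer_fin_num proper_Psi xs_min.
  have expect0 (T : finType) (X : T -> 'rV[R]_0) :
      uniform_expectation (fun w => F (X w) - F xstar)%E = 0%E.
    by rewrite /uniform_expectation big1 ?mule0// => w _; exact: F_eq.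
  split; first by rewrite epoch_length_eq.
    by move=> m _ s h; rewrite expect0 F_eq mule0.
  move=> eps eps0 _ gap S; split; first by move=> m _; rewrite expect0 lee_fin ltW.
  move=> rho rho1; rewrite /gap F_eq /= mul0r => rho0.
  by have := lt_le_trans rho1 rho0; rewrite ltr10.
have sigma_le_L : sigma <= L.
  exact: smoothness_ge_strong_convexity d_gt0
    (upper_smooth_average n_gt0 diff_f upper) strong.
have L_gt0 := lt_le_trans sigma_gt0 sigma_le_L.
split; first by rewrite epoch_length_eq.
  move=> m m_ge s h; under [X in uniform_expectation X]eq_fun => w do rewrite svrg_rcons.
  exact: (uniform_expectation_epoch_le n_gt0 diff_f proper_Psi convex_Psi lsc_Psi
    xs_min sigma_gt0 sigma_le_L L_le_l upper lower strong _ m_ge).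
move=> eps eps0 Fxphi gap S.
have Psi_xphi : Psi xphi \is a fin_num by move: Fxphi; rewrite /F fin_numD.
have gapE : gap = objective_gap f Psi xstar xphi.
  by rewrite /gap /F (objective_gapE proper_Psi xs_min Psi_xphi).
have gap0 : 0 <= gap.
  rewrite gapE; exact: (gap_ge0 n_gt0 diff_f proper_Psi convex_Psi xs_min sigma_gt0 upper strong).
split=> [m m_ge|rho rho1 rho_le m ws].
  have m_gt0 : (0 < m)%N.
    exact: (epoch_length_gt0 sigma_gt0 sigma_le_L L_le_l m_ge).
  rewrite /F (uniform_expectation_gap proper_Psi xs_min); last first.
    by move=> ws; exact: (svrg_fin_num n_gt0 diff_f proper_Psi convex_Psi lsc_Psi
      xs_min sigma_gt0 sigma_le_L L_le_l upper strong ws m_gt0 Psi_xphi).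
  rewrite lee_fin.
  apply: le_trans (mean_svrg_gap_le n_gt0 diff_f proper_Psi convex_Psi lsc_Psi
    xs_min sigma_gt0 sigma_le_L L_le_l upper lower strong S m_ge Psi_xphi) _.
  have epsN0 : eps != 0 by rewrite gt_eqF.
  rewrite -gapE -[gap](divfK epsN0) mulrA.
  apply: ler_piMl; first exact: ltW.
  by apply: expr_log43_le; rewrite divr_ge0// ltW.
pose r := gap / eps; pose kappa := L * l / sigma ^+ 2; rewrite -/r -/kappa in rho_le *.
have lnq : 0 < ln (4 / 3 : R) by rewrite ln_gt0//; lra.
have lnrho : 0 < ln rho by rewrite ln_gt0.
have lnr : ln rho <= ln r by rewrite ler_ln// posrE; lra.
(* This absorbs the 1 lost in rounding up [m]. *)
have kappa1 : 1 <= kappa.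
  rewrite ler_pdivlMr ?exprn_gt0// mul1r expr2.
  by apply: ler_pM => //; [exact: ltW|exact: ltW|exact: le_trans sigma_le_L L_le_l].
have S_le : S%:R <= ((ln (4 / 3))^-1 + (ln rho)^-1) * ln r.
  have log0 : 0 <= log43 r by rewrite divr_ge0 ?ltW// (lt_le_trans lnrho).
  apply: le_trans (nat_ceil_le log0) _; rewrite mulrDl mulrC lerD2l.
  by rewrite ler_pdivlMl// mulr1.
have m_le : m%:R <= 101 * kappa.
  rewrite /m epoch_length_eq -/kappa.
  by apply: le_trans (nat_ceil_le _) _; lra.
rewrite svrg_cost size_tuple natrM.
have C0 : 0 <= ((ln (4 / 3))^-1 + (ln rho)^-1) * ln r.
  by apply: le_trans S_le; rewrite ler0n.
apply: le_trans (_ : ((ln (4 / 3))^-1 + (ln rho)^-1) * ln r * (202 * (n%:R + kappa)) <= _).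
  apply: ler_pM => //; rewrite natrD natrM.
  by have : 0 <= n%:R :> R by []; lra.
by rewrite le_eqVlt; apply/orP; left; apply/eqP; ring.
Qed.
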